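(* Let $\Omega$ and $Z$ be two Polish spaces equipped with their Borel $\sigma$-fields, let $R$ be a $\sigma$-finite positive measure on $\Omega$, and let $\phi:\Omega\to Z$ be a measurable mapping such that the push-forward $R_\phi=\phi_{\#}R$ is $\sigma$-finite on $Z$. Then, for every probability measure $P$ on $\Omega$ for which the relative entropies $H(P|R)$ and $H(P_\phi|R_\phi)$ are defined, $$ H(P|R)=H(P_\phi|R_\phi)+\int_Z H\Big(P(\cdot\mid\phi=z)\,\Big|\,R(\cdot\mid\phi=z)\Big)\,P_\phi(dz). $$
   Context: Positive measures may be unbounded (take the value $+\infty$). For a positive measure $Q$ on $\Omega$, $Q_\phi:=\phi_{\#}Q$ denotes its push-forward by $\phi$. When $Q_\phi$ is $\sigma$-finite, $z\in Z\mapsto Q(\cdot\mid\phi=z)$ denotes the regular conditional probability kernel (a measurable kernel of probability measures on $\Omega$) such that $Q(\cdot)=\int_Z Q(\cdot\mid \phi=z)\,Q_\phi(dz)$ and $Q(\{\phi= z\}\mid\phi=z)=1$ for $Q_\phi$-almost every $z$. Relative entropy. If $R$ is a probability measure on a measurable space $Y$ and $P$ is a probability measure on $Y$, then $H(P|R):=\int_Y\log(dP/dR)\,dP\in[0,\infty]$ if $P\ll R$ and $H(P|R):=\infty$ otherwise. If $R$ is a $\sigma$-finite positive measure on $Y$ and $W:Y\to[0,\infty)$ is a measurable function such that $z_W:=\int_Y e^{-W}\,dR<\infty$, put $R_W:=z_W^{-1}e^{-W}R$ (a probability measure). For every probability measure $P$ on $Y$ such that $\int_Y W\,dP<\infty$,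 one defines $$H(P|R):=H(P|R_W)-\int_Y W\,dP-\log z_W\in(-\infty,\infty].$$ This value does not depend on the choice of such a $W$. The relative entropy $H(P|R)$ is said to be defined if there exists a measurable $W:Y\to[0,\infty)$ with $\int_Y e^{-W}dR<\infty$ and $\int_Y W\,dP<\infty$ (which is always the case when $R$ is bounded, with $W=0$). *)

(* Defs.v *)
From HB Require Import structures.
From mathcomp Require Import all_boot all_order all_algebra.
From mathcomp Require Import all_classical all_reals all_analysis.

Set Implicit Arguments.
Unset Strict Implicit.
Unset Printing Implicit Defensive.

Import Order.TTheory GRing.Theory Num.Theory.

Local Open Scope classical_set_scope.
Local Open Scope ring_scope.
Local Open Scope ereal_scope.

Section polish_space.
Local Open Scope ring_scope.
Context (K : realType) (T : topologicalType).
Implicit Type rho : T -> T -> K.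

Definition is_distance rho : Prop :=
  [/\ forall x y, 0 <= rho x y,
      forall x y, rho x y = 0 <-> x = y,
      forall x y, rho x y = rho y x
    & forall x y z, rho x z <= rho x y + rho y z].

Definition metrizes rho : Prop :=
  forall (x : T) (A : set T),
    nbhs x A <-> exists2 e : K, 0 < e & [set y | rho x y < e] `<=` A.

Definition distance_complete rho : Prop :=
  forall u : nat -> T,
    (forall e : K, 0 < e -> exists N : nat, forall m n : nat,
       (N <= m)%N -> (N <= n)%N -> rho (u m) (u n) < e) ->
    exists l : T, u @ \oo --> l.

Definition polish : Prop :=
  (exists2 D : set T, countable D & dense D) /\
  exists rho, [/\ is_distance rho, metrizes rho & distance_complete rho].

End polish_space.

(* A pointed carrier is required by [measurableType]; it only excludes the
   empty space, on which there is no probability measure. *)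
Notation borel T := (g_sigma_algebraType (@open T)).

Section image_measure.
Context d d' (X : measurableType d) (Y : measurableType d') (K : realType).
Variables (Q : {measure set X -> \bar K}) (phi : {mfun X >-> Y}).

(* Same function as [pushforward], of which it only bundles the measure
   structure; for a probability [Q] it is convertible to [distribution Q phi]. *)
Definition image_measure : set Y -> \bar K := pushforward Q phi.

Let image_measure0 : image_measure set0 = 0.
Proof. exact: measure0. Qed.

Let image_measure_ge0 A : 0 <= image_measure A.
Proof. exact: measure_ge0. Qed.

Let image_measure_sigma_additive : semi_sigma_additive image_measure.
Proof. exact: measure_semi_sigma_additive. Qed.

HB.instance Definition _ := isMeasure.Build _ _ _ image_measure
  image_measure0 image_measure_ge0 image_measure_sigma_additive.

End image_measure.

Section kernels.
Context d d' (Z : measurableType d') (X : measurableType d) (K : realType).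

Definition kernel_prob (k : K.-pker Z ~> X) (z : Z) : set X -> \bar K := k z.

HB.instance Definition _ (k : K.-pker Z ~> X) (z : Z) :=
  Measure.on (kernel_prob k z).
HB.instance Definition _ (k : K.-pker Z ~> X) (z : Z) :=
  Measure_isProbability.Build _ _ _ (kernel_prob k z) (prob_kernel z).

Definition is_regular_conditional (Q : {measure set X -> \bar K})
    (phi : {mfun X >-> Z}) (k : K.-pker Z ~> X) : Prop :=
  (forall A, measurable A -> Q A = \int[image_measure Q phi]_z k z A) /\
  {ae image_measure Q phi, forall z, k z (phi @^-1` [set z]) = 1}.

End kernels.

Section relative_entropy.
Context d (Y : measurableType d) (K : realType).

Local Open Scope charge_scope.

(* The negative part of log (dP/dR) is always P-integrable, so the difference
   of the integrals of the positive and negative parts that defines the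
   integral is never of the form +oo - +oo. *)
Definition prob_entropy (P R : probability Y K) : \bar K :=
  if `[< P `<< R >]
  then \int[P]_x lne (('d (charge_of_finite_measure P) '/d R) x)
  else +oo.

Section exponential_weight.
Variables (R : {measure set Y -> \bar K}) (W : {mfun Y >-> K}).

(* The measure e^{-W} R. *)
Definition exp_weight (A : set Y) : \bar K :=
  \int[R]_(x in A) (expR (- W x))%:E.

Let exp_weight0 : exp_weight set0 = 0.
Proof. exact: integral_set0. Qed.

Let exp_weight_ge0 A : 0 <= exp_weight A.
Proof. by apply: integral_ge0 => x _; rewrite lee_fin expR_ge0. Qed.

Let exp_weight_sigma_additive : semi_sigma_additive exp_weight.
Proof.
apply: semi_sigma_additive_nng_induced.
- apply/measurable_realfun.measurable_EFinP; apply: measurableT_comp => //.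
  exact: measurableT_comp.
- by move=> x; rewrite lee_fin expR_ge0.
Qed.

HB.instance Definition _ := isMeasure.Build _ _ _ exp_weight
  exp_weight0 exp_weight_ge0 exp_weight_sigma_additive.

(* z_W *)
Definition partition_function : \bar K := \int[R]_x (expR (- W x))%:E.

End exponential_weight.

Definition entropy_potential (P : probability Y K)
    (R : {measure set Y -> \bar K}) (W : {mfun Y >-> K}) : Prop :=
  [/\ forall x, (0 <= W x)%R,
      partition_function R W < +oo
    & \int[P]_x (W x)%:E < +oo].

(* [mnormalize (exp_weight R W) P] is R_W when 0 < z_W < +oo.  Its second
   argument is a default value, which for an admissible W is used only if
   z_W = 0, that is R = 0; then [lne 0 = -oo] makes the right-hand side +oo
   whatever the default. *)
Definition entropy_with (P : probability Y K) (R : {measure set Y -> \bar K})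
    (W : {mfun Y >-> K}) : \bar K :=
  prob_entropy P (mnormalize (exp_weight R W) P)
  - \int[P]_x (W x)%:E - lne (partition_function R W).

Definition entropy_defined (P : probability Y K)
    (R : {measure set Y -> \bar K}) : Prop :=
  exists W : {mfun Y >-> K}, entropy_potential P R W.

(* For sigma-finite R the value does not depend on the admissible W chosen.
   When no W is admissible the entropy is not defined and the value +oo is
   arbitrary. *)
Definition relative_entropy (P : probability Y K)
    (R : {measure set Y -> \bar K}) : \bar K :=
  match pselect (entropy_defined P R) with
  | left PR => entropy_with P R (sval (cid PR))
  | right _ => +oo
  end.

End relative_entropy.

(* Main.v *)
Require Import Defs.
From HB Require Import structures.
From mathcomp Require Import all_boot all_order all_algebra.
From mathcomp Require Import all_classical all_reals all_analysis.
From mathcomp Require Import measurable_realfun.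
From mathcomp Require Import ring lra.

(** The chain rule is additivity of the logarithm, once every term is written
    as the integral of the logarithm of a density.

    Suppose first that [P `<< R]. Put [Q := phi # P] and [S := phi # R], and let
    [p] be a density of [P] with respect to [R] and [q] one of [Q] with respect
    to [S]. Whatever the potential [W], the definition of the relative entropy
    unfolds to [H(P|R) = \int ln p dP], and the negative part of [ln p] has a
    finite integral ([relative_entropy_density]); likewise for [q]. For almost
    every [z] the measure [P(.|phi = z)] has the density [p / q z] with respect
    to [R(.|phi = z)] ([ae_density_cond]). For one event this comes from
    integrating over preimages of events of [Z]; for all events at once it uses
    that the Borel sigma-algebra of [Omega] is generated by a countable
    pi-system. The fibre [phi @^-1` [set z]] has full mass, so [q z] may be
    replaced by [q (phi x)], and the conditional entropy at [z] is the integral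
    of [r := ln p - ln (q \o phi)]. Disintegrating [P] gives
    [\int r dP = \int H(P(.|phi = z)|R(.|phi = z)) dQ]
    ([integral_prob_entropy_cond]), and it remains to integrate
    [ln p = ln (q \o phi) + r].

    None of these logarithms need be integrable. What makes the manipulations
    legitimate is that all negative parts have finite integrals: the bound
    [- t ln t <= 1 - t] shows that the negative part of the logarithm of a
    density between two probability measures integrates to at most 1
    ([integral_ln_density]).

    If [P] is not dominated by [R], the left-hand side is [+oo]. Either [Q] is
    not dominated by [S], and the first term on the right is [+oo]; or some
    event charged by [P] but not by [R] is charged by [P(.|phi = z)] and not by
    [R(.|phi = z)] for [z] in a set of positive [Q]-measure, so that the
    integral on the right is [+oo] ([cond_entropyNac]). *)

Set Implicit Arguments.
Unset Strict Implicit.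
Unset Printing Implicit Defensive.

Import Order.TTheory GRing.Theory Num.Theory.

Local Open Scope classical_set_scope.
Local Open Scope ring_scope.
Local Open Scope ereal_scope.

(** * Integration against mixtures *)

Section disintegration.
Context d d' (Z : measurableType d) (X : measurableType d') (K : realType).
Variables (mu : {measure set Z -> \bar K}) (nu : {measure set X -> \bar K}).
Variable k : Z -> {measure set X -> \bar K}.
Hypothesis mk : forall A, measurable A -> measurable_fun [set: Z] (k ^~ A).
Hypothesis nuE : forall A, measurable A -> nu A = \int[mu]_z k z A.

Import HBNNSimple.

Let integral_mixture_nnsfun (h : {nnsfun X >-> K}) :
  \int[nu]_x (h x)%:E = \int[mu]_z \int[k z]_x (h x)%:E.
Proof.
have hE (m : {measure set X -> \bar K}) : \int[m]_x (h x)%:E =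
    \sum_(y \in range h) y%:E * m (h @^-1` [set y]).
  by rewrite integralT_nnsfun sintegralE.
rewrite hE; under [RHS]eq_integral do rewrite hE.
have h0 y : range h y -> (0 <= y)%R by move=> [x _ <-].
rewrite ge0_integral_fsum//; last 2 first.
- by move=> y; apply: measurable_funeM; exact: mk.
- move=> y z _; have [y0|y0] := leP 0%R y; first by rewrite mule_ge0.
  rewrite (_ : _ @^-1` _ = set0) ?measure0 ?mule0//.
  by apply/seteqP; split => // x /= hx; move: y0; rewrite -hx ltNge fun_ge0.
apply: eq_fsbigr => y; rewrite inE => yh.
by rewrite ge0_integralZl ?nuE//; [exact: mk|rewrite lee_fin h0].
Qed.

(** From indicators to nonnegative functions by monotone convergence. It serves
    both for disintegrations and, with [k x := h x * \d_x], for densities. *)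
Lemma integral_mixture (g : X -> \bar K) : measurable_fun setT g ->
    (forall x, 0 <= g x) ->
  \int[nu]_x g x = \int[mu]_z \int[k z]_x g x.
Proof.
move=> mg g0; pose h := nnsfun_approx measurableT mg.
have gE (m : {measure set X -> \bar K}) :
    \int[m]_x g x = lim (\int[m]_x (h n x)%:E @[n --> \oo]).
  have gh x : setT x -> g x = lim ((h n x)%:E @[n --> \oo]).
    by move=> _; apply/esym/cvg_lim => //; exact: cvg_nnsfun_approx.
  under eq_integral => x _ do rewrite gh//.
  apply: monotone_convergence => //.
  - by move=> n; exact/measurable_EFinP.
  - by move=> n x _ /=; rewrite lee_fin.
  - by move=> x _ a b ab; rewrite lee_fin; exact/lefP/nd_nnsfun_approx.
rewrite gE; under [RHS]eq_integral do rewrite gE.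
rewrite monotone_convergence//.
- by under eq_fun do rewrite integral_mixture_nnsfun.
- move=> n; apply: measurable_fun_integral_kernel => //.
  + by move=> x; rewrite lee_fin.
  + exact/measurable_EFinP.
- by move=> n z _; apply: integral_ge0 => x _; rewrite lee_fin.
- move=> z _ a b ab; apply: ge0_le_integral => //.
  + by move=> x _; rewrite lee_fin.
  + exact/measurable_EFinP.
  + exact/measurable_EFinP.
  + by move=> x _; rewrite lee_fin; exact/lefP/nd_nnsfun_approx.
Qed.

End disintegration.

(** * Densities and integrals that may be infinite *)

Section integral.
Context d (X : measurableType d) (K : realType).
Implicit Types mu nu : {measure set X -> \bar K}.

Import HBNNSimple.

(** Real values, rather than extended ones, let [ln] of a density be a real
    function, so that logarithms can be added and subtracted freely. *)
Definition is_density mu nu (h : X -> K) : Prop :=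
  [/\ measurable_fun setT h, forall x, (0 <= h x)%R &
   forall A, measurable A -> nu A = \int[mu]_(x in A) (h x)%:E].

Lemma integral_density mu nu (h : X -> K) (g : X -> \bar K) :
  is_density mu nu h -> measurable_fun setT g -> (forall x, 0 <= g x) ->
  \int[nu]_x g x = \int[mu]_x ((h x)%:E * g x).
Proof.
move=> [mh h0 nuE] mg g0.
rewrite (@integral_mixture _ _ _ _ _ mu nu
  (fun x => mscale (NngNum (h0 x)) \d_x))//.
- apply: eq_integral => x _ /=.
  by rewrite ge0_integral_mscale//= integral_dirac//= diracT mul1e.
- move=> A mA; rewrite /mscale/=; apply: emeasurable_funM.
    exact/measurable_EFinP.
  exact/measurable_EFinP/measurable_indic.
- move=> A mA; rewrite nuE// integral_mkcond; apply: eq_integral => x _.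
  rewrite -[RHS]/((h x)%:E * \d_x A) patchE diracE.
  by case: ifPn => _; rewrite ?mule1 ?mule0.
Qed.

(** The integral of a nonnegative function is the supremum of the integrals of
    the simple functions below it, and these may be cut off on a null set. The
    comparison thus applies to conditional entropies, which are only almost
    everywhere equal to a measurable function of [z]. *)
Lemma ae_ge0_le_integral_nomeas mu (f g : X -> \bar K) :
  (forall x, 0 <= f x) -> (forall x, 0 <= g x) ->
  {ae mu, forall x, f x <= g x} -> \int[mu]_x f x <= \int[mu]_x g x.
Proof.
move=> f0 g0 [N [mN N0 fgN]].
rewrite !ge0_integralTE//; apply: ge_ereal_sup => _ [h /= hf <-].
have mNc : measurable (~` N) by exact: measurableC.
apply: ereal_sup_ge; exists (sintegral mu (proj_nnsfun h mNc)).
  exists (proj_nnsfun h mNc) => // x /=.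
  rewrite -[X in X%:E]/(h x * \1_(~` N) x)%R indicE.
  have [/set_mem Nx|Nx] := boolP (x \in N).
    by rewrite in_setC mem_set//= mulr0.
  rewrite in_setC Nx mulr1; apply: le_trans (hf x) _.
  by apply: contrapT => fg; move: Nx => /negP; apply; apply/mem_set/fgN.
rewrite -!integralT_nnsfun; apply: ae_ge0_le_integral => //.
- by move=> x _; rewrite lee_fin.
- exact/measurable_EFinP.
- by move=> x _; rewrite lee_fin.
- exact/measurable_EFinP.
- exists N; split => // x /= /not_implyP[_].
  rewrite lee_fin -[X in (_ <= X)%R]/(h x * \1_(~` N) x)%R indicE in_setC.
  by have [/set_mem//|_] := boolP (x \in N); rewrite mulr1 lexx.
Qed.

Lemma ae_eq_integral_nomeas mu (f g : X -> \bar K) :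
  {ae mu, forall x, f x = g x} -> \int[mu]_x f x = \int[mu]_x g x.
Proof.
move=> fg; rewrite integralE [RHS]integralE.
congr (_ - _); apply/eqP; rewrite eq_le !ae_ge0_le_integral_nomeas//.
all: by apply: filterS fg => x fgx; rewrite ?funeposE ?funenegE fgx.
Qed.

(** The functions whose integral is a real number or [+oo]. Excluding [-oo] as
    well as [+oo - +oo] makes the class stable under addition. *)
Definition lower_integrable mu (f : X -> K) : Prop :=
  measurable_fun setT f /\ \int[mu]_x (EFin \o f)^\- x < +oo.

Let meas_posneg (h : X -> K) : measurable_fun setT h ->
  measurable_fun setT (EFin \o h)^\+ /\ measurable_fun setT (EFin \o h)^\-.
Proof.
by move=> mh; split; [apply: measurable_funepos|apply: measurable_funeneg];
  exact/measurable_EFinP.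
Qed.

Lemma lower_integrableD mu (f g : X -> K) :
  lower_integrable mu f -> lower_integrable mu g ->
  lower_integrable mu (f \+ g)%R.
Proof.
move=> [mf fn] [mg gn]; split; first exact: measurable_funD.
have [mfp mfn] := meas_posneg mf; have [mgp mgn] := meas_posneg mg.
have [mhp mhn] := meas_posneg (measurable_funD mf mg).
apply: le_lt_trans (lte_add_pinfty fn gn).
rewrite -ge0_integralD//; apply: ge0_le_integral => //.
  exact: emeasurable_funD.
move=> x _; rewrite !funenegE -!EFin_max lee_fin.
rewrite ge_max addr_ge0 ?le_max ?lexx ?orbT// andbT opprD.
by rewrite lerD// le_max lexx.
Qed.

Lemma ae_eq_lower_integrable mu (f g : X -> K) : measurable_fun setT g ->
  {ae mu, forall x, f x = g x} -> lower_integrable mu f ->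
  lower_integrable mu g.
Proof.
move=> mg fg [mf fn]; split => //.
rewrite (_ : integral _ _ _ = \int[mu]_x (EFin \o f)^\- x)//.
apply: ae_eq_integral_nomeas.
by apply: filterS fg => x fgx; rewrite !funenegE/= fgx.
Qed.

(** Rearranging [h^+ - h^- = (f^+ - f^-) + (g^+ - g^-)], where [h := f + g],
    into an equality between sums of nonnegative functions, then cancelling the
    finite integrals of the negative parts. *)
Lemma integralD_lower_integrable mu (f g : X -> K) :
  lower_integrable mu f -> lower_integrable mu g ->
  \int[mu]_x (f x + g x)%:E = \int[mu]_x (f x)%:E + \int[mu]_x (g x)%:E.
Proof.
move=> lf lg; have [_ hn] := lower_integrableD lf lg.
move: lf lg => [mf fn] [mg gn].
have [mfp mfn] := meas_posneg mf; have [mgp mgn] := meas_posneg mg.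
have [mhp mhn] := meas_posneg (measurable_funD mf mg).
set h := (f \+ g)%R.
have iE (u : X -> K) : \int[mu]_x (u x)%:E =
    \int[mu]_x (EFin \o u)^\+ x - \int[mu]_x (EFin \o u)^\- x.
  by rewrite integralE.
rewrite (iE h) (iE f) (iE g).
have hE x : (EFin \o h)^\+ x + ((EFin \o f)^\- x + (EFin \o g)^\- x) =
    (EFin \o h)^\- x + ((EFin \o f)^\+ x + (EFin \o g)^\+ x).
  rewrite !funeposE !funenegE/= -!EFin_max -!EFinD; congr EFin.
  have maxN (c : K) : (Num.max c 0 = Num.max (- c) 0 + c)%R.
    by rewrite addr_maxl addNr add0r maxC.
  by rewrite (maxN (h x)) (maxN (f x)) (maxN (g x)) /h/=; ring.
have iD (u v : X -> \bar K) : measurable_fun setT u -> measurable_fun setT v ->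
    (forall x, 0 <= u x) -> (forall x, 0 <= v x) ->
    \int[mu]_x (u x + v x) = \int[mu]_x u x + \int[mu]_x v x.
  by move=> mU mV u0 v0; rewrite ge0_integralD.
have : \int[mu]_x (EFin \o h)^\+ x +
    (\int[mu]_x (EFin \o f)^\- x + \int[mu]_x (EFin \o g)^\- x) =
    \int[mu]_x (EFin \o h)^\- x +
    (\int[mu]_x (EFin \o f)^\+ x + \int[mu]_x (EFin \o g)^\+ x).
  rewrite -!iD//; last 4 first.
  - exact: emeasurable_funD.
  - by move=> x; rewrite adde_ge0.
  - exact: emeasurable_funD.
  - by move=> x; rewrite adde_ge0.
  exact: eq_integral.
have fin (u : X -> \bar K) : \int[mu]_x u^\- x < +oo ->
    \int[mu]_x u^\- x \is a fin_num.
  by move=> ?; rewrite ge0_fin_numE// integral_ge0.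
move: hn; rewrite -/h => /fin hn; move: hn (fin _ fn) (fin _ gn).
have : 0 <= \int[mu]_x (EFin \o f)^\+ x by exact: integral_ge0.
have : 0 <= \int[mu]_x (EFin \o g)^\+ x by exact: integral_ge0.
move: (\int[mu]_x (EFin \o h)^\+ x) (\int[mu]_x (EFin \o h)^\- x)
  (\int[mu]_x (EFin \o f)^\+ x) (\int[mu]_x (EFin \o f)^\- x)
  (\int[mu]_x (EFin \o g)^\+ x) (\int[mu]_x (EFin \o g)^\- x).
move=> [a||] [b||] [c||] [d'||] [e||] [i||]//= _ _ _ _ _ [] abc.
by congr EFin; lra.
Qed.

End integral.

Section densities.
Context d (X : measurableType d) (K : realType).
Implicit Types mu nu : {measure set X -> \bar K}.

Lemma density_null_dominates mu nu (h : X -> K) :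
  is_density mu nu h -> nu `<< mu.
Proof.
move=> [mh h0 nuE]; apply/null_content_dominatesP => A mA muA0.
rewrite nuE//; apply: null_set_integral => //.
exact/measurable_funTS/measurable_EFinP.
Qed.

Lemma density_gt0 mu nu (h : X -> K) :
  is_density mu nu h -> {ae nu, forall x, (0 < h x)%R}.
Proof.
move=> [mh h0 nuE]; exists (h @^-1` [set 0%R]); split.
- by rewrite -[X in measurable X]setTI; exact: mh.
- rewrite nuE; last by rewrite -[X in measurable X]setTI; exact: mh.
  by apply: integral0_eq => x /= ->.
- by move=> x /= /negP; rewrite -leNgt => hx; apply/eqP; rewrite eq_le hx h0.
Qed.

Lemma density_trans mu nu (pi : {measure set X -> \bar K}) (h g : X -> K) :
  is_density mu nu h -> is_density nu pi g -> is_density mu pi (h \* g)%R.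
Proof.
move=> hh [mg g0 piE]; have [mh h0 _] := hh; split.
- exact: measurable_funM.
- by move=> x; rewrite mulr_ge0.
- move=> A mA; rewrite piE// integral_mkcond (integral_density hh).
  + rewrite [RHS]integral_mkcond; apply: eq_integral => x _.
    by rewrite !patchE; case: ifPn => _; rewrite ?mule0.
  + by apply/(measurable_restrictT _ mA)/measurable_funTS/measurable_EFinP.
  + by apply: erestrict_ge0 => x _; rewrite lee_fin.
Qed.

(** A density of a finite measure is integrable, hence determined up to a null
    set by its integrals over events. *)
Lemma density_ae_unique mu nu (h : X -> K) (g : X -> \bar K) :
  nu setT < +oo -> is_density mu nu h -> measurable_fun setT g ->
  (forall A, measurable A -> nu A = \int[mu]_(x in A) g x) ->
  {ae mu, forall x, (h x)%:E = g x}.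
Proof.
move=> nuoo [mh h0 nuE] mg nuE'.
have : ae_eq mu setT (EFin \o h) g.
  apply: integral_ae_eq => //.
  - apply/integrableP; split; first exact/measurable_EFinP.
    under eq_integral do rewrite /= ger0_norm//.
    by rewrite -nuE.
  - by move=> A _ mA; rewrite -nuE// nuE'.
by apply: filterS => x; exact.
Qed.

(** Integrating the pointwise bound [- p ln p <= 1 - p] against [R] gives both
    the bound on the negative part and Gibbs' inequality. *)
Lemma integral_ln_density (P R : probability X K) (p : X -> K) :
  is_density R P p ->
  [/\ lower_integrable P (fun x => ln (p x)),
      \int[P]_x (EFin \o (fun x => ln (p x)))^\- x <= 1 &
      0 <= \int[P]_x (ln (p x))%:E].
Proof.
move=> pP; have [mp p0 PE] := pP.
have mlp : measurable_fun setT (fun x => ln (p x)).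
  by apply: measurableT_comp mp; exact: measurable_ln.
pose L := EFin \o (fun x => ln (p x)).
have mL : measurable_fun setT L by exact/measurable_EFinP.
have mLp : measurable_fun setT L^\+ by exact: measurable_funepos.
have mLn : measurable_fun setT L^\- by exact: measurable_funeneg.
have mpE : measurable_fun setT (EFin \o p) by exact/measurable_EFinP.
have plnp x : (p x * - ln (p x) <= 1 - p x)%R.
  have := p0 x; rewrite le_eqVlt => /predU1P[<-|px0].
    by rewrite mul0r subr0.
  have : (ln (1 + ((p x)^-1 - 1)) <= (p x)^-1 - 1)%R.
    by apply: le_ln1Dx; rewrite ltrBrDl addrN invr_gt0.
  rewrite subrKC lnV ?posrE// -(ler_pM2l px0) => /le_trans; apply.
  by rewrite mulrBr mulr1 divff// gt_eqF.
have main x : (p x * Num.max (- ln (p x)) 0 + p x <=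
               p x * Num.max (ln (p x)) 0 + 1)%R.
  have -> : (Num.max (ln (p x)) 0 = Num.max (- ln (p x)) 0 + ln (p x))%R.
    by rewrite addr_maxl addNr add0r maxC.
  by have := plnp x; lra.
have bound x : (p x * Num.max (- ln (p x)) 0 <= 1)%R.
  rewrite /Num.max; case: ifPn => _; first by rewrite mulr0.
  by have := plnp x; have := p0 x; lra.
have P1 : \int[R]_x (p x)%:E = 1.
  by rewrite -PE//; exact: probability_setT.
have R1 : \int[R]_x (cst 1 x) = 1
  by rewrite integral_cst// mul1e; exact: probability_setT.
have negE : \int[P]_x L^\- x = \int[R]_x ((p x)%:E * L^\- x).
  exact: integral_density.
have posE : \int[P]_x L^\+ x = \int[R]_x ((p x)%:E * L^\+ x).
  exact: integral_density.
have mpn : measurable_fun setT (fun x => (p x)%:E * L^\- x).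
  exact: emeasurable_funM.
have mpp : measurable_fun setT (fun x => (p x)%:E * L^\+ x).
  exact: emeasurable_funM.
have neg1 : \int[P]_x L^\- x <= 1.
  rewrite negE -R1; apply: ge0_le_integral => //.
  - by move=> x _; rewrite mule_ge0// lee_fin.
  - by move=> x _; rewrite funenegE -EFinN -EFin_max -EFinM lee_fin.
have negfin : \int[P]_x L^\- x \is a fin_num.
  by rewrite ge0_fin_numE ?integral_ge0// (le_lt_trans neg1)// ltry.
split => //.
  by split => //; apply: le_lt_trans neg1 _; rewrite ltry.
rewrite integralE -/L sube_ge0; last by rewrite negfin.
rewrite -(leeD2rE _ _ (isT : 1 \is a fin_num)).
rewrite negE posE -[X in _ + X <= _]P1 -[X in _ <= _ + X]R1.
rewrite -!ge0_integralD//.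
- apply: ge0_le_integral => //.
  + by move=> x _; rewrite adde_ge0 ?mule_ge0 ?lee_fin.
  + exact: emeasurable_funD.
  + exact: emeasurable_funD.
  + move=> x _; rewrite funenegE funeposE -EFinN -!EFin_max -!EFinM -!EFinD.
    by rewrite lee_fin.
- by move=> x _; rewrite mule_ge0// lee_fin.
- by move=> x _; rewrite mule_ge0// lee_fin.
- by move=> x _; rewrite lee_fin.
Qed.

End densities.

(** * Relative entropy as the integral of a logarithmic density *)

Section entropy.
Context d (X : measurableType d) (K : realType).
Implicit Types P R : probability X K.
Local Open Scope charge_scope.

Lemma prob_entropy_density P R (p : X -> K) : is_density R P p ->
  prob_entropy P R = \int[P]_x (ln (p x))%:E.
Proof.
move=> pP; have PR := density_null_dominates pP.
have [mp p0 _] := pP.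
rewrite /prob_entropy asboolT//.
set g := 'd _ '/d _.
have mg : measurable_fun setT g.
  exact/measurable_int/Radon_Nikodym_integrable.
have [N [mN N0 pgN]] : {ae R, forall x, (p x)%:E = g x}.
  apply: density_ae_unique pP mg _; last first.
    by move=> A mA; rewrite /g -Radon_Nikodym_integral.
  by rewrite ltey_eq fin_num_measure.
have pgP : {ae P, forall x, (p x)%:E = g x}.
  by exists N; split => //; move/null_content_dominatesP : PR; exact.
apply: ae_eq_integral_nomeas.
by apply: filterS2 pgP (density_gt0 pP) => x <- px0; rewrite lne_EFin.
Qed.

Lemma density_exists P R : P `<< R -> exists p : X -> K, is_density R P p.
Proof.
move=> PR; pose f := Radon_Nikodym_SigmaFinite.f P R.
have fE x : (fine (f x))%:E = f x.
  by rewrite fineK// Radon_Nikodym_SigmaFinite.f_fin_num.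
exists (fine \o f); split.
- apply/measurable_EFinP; rewrite (_ : _ \o _ = f); last exact/funext.
  exact: measurable_int (Radon_Nikodym_SigmaFinite.f_integrable PR).
- by move=> x; rewrite fine_ge0// Radon_Nikodym_SigmaFinite.f_ge0.
- move=> A mA; rewrite [LHS](Radon_Nikodym_SigmaFinite.f_integral PR mA).
  by apply: eq_integral => x _; rewrite fE.
Qed.

Lemma prob_entropy_ge0 P R : 0 <= prob_entropy P R.
Proof.
have [PR|PR] := pselect (P `<< R); last by rewrite /prob_entropy asboolF.
have [p pP] := density_exists PR.
by rewrite (prob_entropy_density pP); have [] := integral_ln_density pP.
Qed.

Section potential.
Variables (R : {measure set X -> \bar K}) (W : {mfun X >-> K}).
Let z := partition_function R W.

Lemma partition_function_ge0 : 0 <= z.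
Proof. by apply: integral_ge0 => x _; rewrite lee_fin expR_ge0. Qed.

Lemma exp_weight_eq0 A : measurable A -> exp_weight R W A = 0 -> R A = 0.
Proof.
move=> mA RWA0; have me : measurable_fun A (fun x => (expR (- W x))%:E).
  apply/measurable_funTS/measurable_EFinP.
  by apply: measurableT_comp => //; exact: measurableT_comp.
have : \int[R]_(x in A) `|(expR (- W x))%:E| = 0.
  rewrite -[RHS]RWA0; apply: eq_integral => x _.
  by rewrite gee0_abs// lee_fin expR_ge0.
move/(ae_eq_integral_abs _ mA me) => [N [mN N0 AN]].
apply: subset_measure0 N0 => // x Ax; apply: AN => /= /(_ Ax)[]/eqP.
by rewrite gt_eqF// expR_gt0.
Qed.

Hypotheses (z0 : z != 0) (zoo : z < +oo).

Lemma fine_partition_function_gt0 : (0 < fine z)%R.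
Proof. by rewrite fine_gt0// zoo andbT lt0e z0 partition_function_ge0. Qed.

Let z_gt0 := fine_partition_function_gt0.

Let mnormalizeE P A :
  mnormalize (exp_weight R W) P A = exp_weight R W A * (fine z)^-1%:E.
Proof. by rewrite /mnormalize /= -/z (negbTE z0) (lt_eqF zoo). Qed.

Lemma density_mnormalize P : is_density R (mnormalize (exp_weight R W) P)
  (fun x => (fine z)^-1 * expR (- W x))%R.
Proof.
have me : measurable_fun setT (fun x => (expR (- W x))).
  by apply: measurableT_comp => //; exact: measurableT_comp.
split.
- exact: measurable_funM.
- by move=> x; rewrite mulr_ge0 ?expR_ge0// invr_ge0 ltW.
- move=> A mA; rewrite [LHS]mnormalizeE muleC -ge0_integralZl//.
  + exact/measurable_funTS/measurable_EFinP.
  + by rewrite lee_fin invr_ge0 ltW.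
Qed.

Lemma null_dominates_mnormalize P (nu : set X -> \bar K) :
  nu `<< R -> nu `<< mnormalize (exp_weight R W) P.
Proof.
move=> /null_content_dominatesP nuR; apply/null_content_dominatesP => A mA.
rewrite [X in X = _ -> _]mnormalizeE => /eqP.
rewrite mule_eq0 => /orP[/eqP RWA|].
  by apply: nuR => //; exact: exp_weight_eq0.
by rewrite eqe invr_eq0 gt_eqF.
Qed.

End potential.

(** With [f] a density of [P] with respect to the probability [R_W], the density
    with respect to [R] is [f e^{-W} / z_W]; the logarithm of the last two
    factors is [- W - ln z_W], which is what [entropy_with] adds to [\int ln f],
    so the result no longer mentions [W]. *)
Lemma entropy_with_density P (R : {measure set X -> \bar K}) W :
  entropy_potential P R W -> P `<< R -> exists p : X -> K,
  [/\ is_density R P p, lower_integrable P (fun x => ln (p x)) &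
      entropy_with P R W = \int[P]_x (ln (p x))%:E].
Proof.
move=> [W0 zoo Woo] PR; set z := partition_function R W in zoo.
have z0 : z != 0.
  apply/eqP => /(exp_weight_eq0 measurableT) RT.
  have /null_content_dominatesP/(_ _ measurableT RT) := PR.
  by move/eqP; rewrite [X in X == _]probability_setT eqe oner_eq0.
have zfin : z \is a fin_num.
  by rewrite ge0_fin_numE// partition_function_ge0.
have z_gt0 : (0 < fine z)%R by exact: fine_partition_function_gt0.
have PRW : P `<< mnormalize (exp_weight R W) P.
  exact: null_dominates_mnormalize.
have [f fP] := density_exists PRW.
have pP := density_trans (density_mnormalize z0 zoo P) fP.
set p := (_ \* f)%R in pP.
have [lf _ _] := integral_ln_density fP.
have lW : lower_integrable P (fun x => - W x)%R.
  split; first exact: measurableT_comp.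
  rewrite (_ : integral _ _ _ = \int[P]_x (W x)%:E)//.
  by apply: eq_integral => x _; rewrite funenegE/= opprK -EFin_max max_l.
have lc : lower_integrable P (cst (- ln (fine z))%R).
  split => //; rewrite (_ : _^\- = cst (Num.max (ln (fine z)) 0)%:E).
    by rewrite integral_cst// [X in _ * X]probability_setT mule1 ltry.
  by apply/funext => x; rewrite funenegE/= opprK -EFin_max.
have lWc := lower_integrableD lW lc.
have lall := lower_integrableD lf lWc.
have lnpE : {ae P, forall x, (ln (f x) + (- W x - ln (fine z)))%R = ln (p x)}.
  apply: filterS (density_gt0 fP) => x fx0.
  rewrite /p/= !lnM ?posrE ?mulr_gt0 ?invr_gt0 ?expR_gt0// lnV ?posrE// expRK.
  by ring.
exists p; split => //.
- apply: ae_eq_lower_integrable lall => //.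
  by apply: measurableT_comp; [exact: measurable_ln|case: pP].
- rewrite /entropy_with (prob_entropy_density fP) -/z.
  transitivity (\int[P]_x (ln (f x) + (- W x - ln (fine z)))%:E); last first.
    by apply: ae_eq_integral_nomeas; apply: filterS lnpE => x ->.
  rewrite integralD_lower_integrable// integralD_lower_integrable//.
  rewrite addeA; congr (_ + _ + _).
    by rewrite -integral_ge0N// => x _; rewrite lee_fin.
  rewrite integral_cst// [X in _ * X]probability_setT mule1.
  by rewrite -[z in LHS]fineK// lne_EFin.
Qed.

(** When [R] is the zero measure, [z_W = 0] and it is [- lne 0 = +oo] that gives
    the value. *)
Lemma entropy_withNac P (R : {measure set X -> \bar K}) W :
  entropy_potential P R W -> ~ P `<< R -> entropy_with P R W = +oo.
Proof.
move=> [W0 zoo Woo] PR; rewrite /entropy_with; set z := partition_function R W.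
have z_ge0 : 0 <= z by exact: partition_function_ge0.
have Wfin : \int[P]_x (W x)%:E \is a fin_num.
  by rewrite ge0_fin_numE// integral_ge0// => x _; rewrite lee_fin.
have [z0|z0] := eqVneq z 0.
  rewrite z0 le0_lneNy// addey//.
  have := prob_entropy_ge0 P (mnormalize (exp_weight R W) P).
  by move: Wfin; case: (integral _ _ _) => // r _; case: prob_entropy.
have zfin : z \is a fin_num by rewrite ge0_fin_numE.
have -> : prob_entropy P (mnormalize (exp_weight R W) P) = +oo.
  rewrite /prob_entropy asboolF// => PRW; apply: PR.
  apply: null_dominates_trans PRW _.
  exact: density_null_dominates (density_mnormalize z0 zoo P).
rewrite -(fineK Wfin) -(fineK zfin) lne_EFin//.
exact: fine_partition_function_gt0.
Qed.

Lemma relative_entropy_density P (R : {measure set X -> \bar K}) :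
  entropy_defined P R -> P `<< R -> exists p : X -> K,
  [/\ is_density R P p, lower_integrable P (fun x => ln (p x)) &
      relative_entropy P R = \int[P]_x (ln (p x))%:E].
Proof.
move=> PR; rewrite /relative_entropy; case: pselect => // PR'.
exact/entropy_with_density/(svalP (cid PR')).
Qed.

Lemma relative_entropyNac P (R : {measure set X -> \bar K}) :
  ~ P `<< R -> relative_entropy P R = +oo.
Proof.
move=> PR; rewrite /relative_entropy; case: pselect => // PR'.
exact: entropy_withNac (svalP (cid PR')) PR.
Qed.

End entropy.

(** * Borel sets of a Polish space *)

Section polish.
Context (K : realType) (T : ptopologicalType).
Hypothesis polishT : polish K T.

Let rho_ball (rho : T -> T -> K) (x : T) (e : K) := [set y | (rho x y < e)%R].

Let open_ball rho x e : is_distance rho -> metrizes rho ->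
  open (rho_ball rho x e).
Proof.
move=> [rho0 rhoE rhoC rhoT] rhom; rewrite openE => y /= xy.
apply/rhom; exists (e - rho x y)%R; first by rewrite subr_gt0.
by move=> w /= yw; rewrite /rho_ball/=; have := rhoT x y w; lra.
Qed.

Lemma polish_measurable_set1 (x : T) : measurable ([set x] : set (borel T)).
Proof.
have [_ [rho [[rho0 rhoE rhoC rhoT] rhom _]]] := polishT.
rewrite -[X in measurable X]setCK; apply: measurableC.
apply: sub_sigma_algebra; rewrite openE => y /= yx.
apply/rhom; exists (rho y x).
  rewrite lt_neqAle rho0 andbT; apply/eqP => /esym/rhoE; exact: yx.
by move=> w /= + wx; rewrite wx ltxx.
Qed.

(** The pi-system consists of the finite intersections of the balls of radius
    [1 / n.+1] centred at the points of a countable dense set. *)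
Lemma polish_countably_generated : exists G : set (set (borel T)),
  [/\ countable G, setI_closed G, G setT & measurable = <<s G >>].
Proof.
have [[S cS dS] [rho [rhod rhom _]]] := polishT.
have [rho0 rhoE rhoC rhoT] := rhod.
have [a Sa] : exists a : nat -> T, S `<=` range a.
  have /pfcard_geP[->|[f]] := cS; first by exists (cst point).
  by exists f => x Sx; have [n _ <-] := @surj _ _ _ _ f x Sx; exists n.
pose B (i : nat * nat) : set (borel T) := rho_ball rho (a i.1) i.2.+1%:R^-1.
have oB i : open (B i : set T) by exact: open_ball.
pose G := finI_from [set: nat * nat] B.
exists G; split.
- exact/finI_from_countable/countableP.
- by move=> C D GC GD; exact: finI_fromI.
- by rewrite -[X in G X](bigcap_set0 B) -set_fset0; exists (finmap.fset0).
apply/seteqP; split.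
- apply: smallest_sub; first exact: smallest_sigma_algebra.
  move=> U oU.
  have -> : U = \bigcup_i (if `[< B i `<=` U >] then B i else set0).
    apply/seteqP; split => [x Ux|x [i _]]; last by case: asboolP => // BU /BU.
    have [e e0 eU] : exists2 e : K, (0 < e)%R & rho_ball rho x e `<=` U.
      by apply/rhom; move: oU; rewrite openE; exact.
    (* half of [e], since a ball through [x] is centred at a nearby point *)
    have [n ne] : exists n : nat, (n.+1%:R^-1 < e / 2)%R.
      exists (Num.truncn (e / 2)^-1).
      by rewrite invf_plt ?posrE ?divr_gt0// truncnS_gt.
    have [|s [xs Ss]] :=
        dS (rho_ball rho x n.+1%:R^-1) _ (open_ball _ _ rhod rhom).
      exists x; rewrite /rho_ball/=; have /rhoE -> : x = x by [].
      by rewrite invr_gt0.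
    have [m _ ams] := Sa _ Ss.
    exists (m, n) => //; rewrite asboolT.
      by rewrite /B /rho_ball/= ams rhoC.
    move=> y; rewrite /B/= ams => sy; apply: eU; rewrite /rho_ball/= in xs sy *.
    apply: le_lt_trans (rhoT x s y) _; rewrite (splitr e).
    by apply: ltrD; [exact: lt_trans xs ne|exact: lt_trans sy ne].
  apply: (@countable_bigcupT_measurable _ (g_sigma_algebraType G)).
    exact: countableP.
  move=> i; case: asboolP => // _; apply: sub_sigma_algebra.
  exact: finI_from1.
- apply: smallest_sub; first exact: smallest_sigma_algebra.
  move=> _ [D _ <-]; rewrite bigcap_fset; apply: bigsetI_measurable => i _.
  exact: sub_sigma_algebra.
Qed.

End polish.

(** * Regular conditional probabilities *)

Lemma measure_of_density d (X : measurableType d) (K : realType)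
    (mu : {measure set X -> \bar K}) (h : X -> \bar K) :
  measurable_fun setT h -> (forall x, 0 <= h x) ->
  exists m : {measure set X -> \bar K}, forall A, m A = \int[mu]_(x in A) h x.
Proof.
move=> mh h0; pose m A := \int[mu]_(x in A) h x.
have m0 : m set0 = 0 by exact: integral_set0.
have m_ge0 A : 0 <= m A by exact: integral_ge0.
have m_sigma : semi_sigma_additive m by exact: semi_sigma_additive_nng_induced.
pose mM := isMeasure.Build _ _ _ m m0 m_ge0 m_sigma.
pose m' : {measure set X -> \bar K} := HB.pack m mM.
by exists m'.
Qed.

Section regular_conditional.
Context d d' (X : measurableType d) (Z : measurableType d') (K : realType).
Variables (Q : {measure set X -> \bar K}) (phi : {mfun X >-> Z}).
Variable k : K.-pker Z ~> X.
Hypothesis mset1 : forall z : Z, measurable [set z].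
Hypothesis kQ : is_regular_conditional Q phi k.

Lemma regular_conditional_fiber :
  {ae image_measure Q phi, forall z, {ae k z, forall x, phi x = z}}.
Proof.
have [_] := kQ; apply: filterS => z kz1.
have mz : measurable (phi @^-1` [set z]).
  by rewrite -[X in measurable X]setTI; exact: measurable_funP.
exists (~` (phi @^-1` [set z])); split => //; first exact: measurableC.
have := probability_setC (kernel_prob k z) mz.
by rewrite /kernel_prob kz1 subee.
Qed.

(** The restriction to [phi @^-1` B] passes through the kernel because
    [k z] lives on the fibre over [z], which is either inside that preimage or
    disjoint from it. *)
Lemma integral_regular_conditional (g : X -> \bar K) (B : set Z) :
  measurable B -> measurable_fun setT g -> (forall x, 0 <= g x) ->
  \int[Q]_(x in phi @^-1` B) g x =
  \int[image_measure Q phi]_(z in B) \int[k z]_x g x.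
Proof.
move=> mB mg g0; have mphiB : measurable (phi @^-1` B).
  by rewrite -[X in measurable X]setTI; exact: measurable_funP.
rewrite integral_mkcond (@integral_mixture _ _ _ _ _ (image_measure Q phi) _ k).
- rewrite [RHS]integral_mkcond; apply: ae_eq_integral_nomeas.
  apply: filterS regular_conditional_fiber => z kz; rewrite patchE.
  case: ifPn => zB.
    apply: ae_eq_integral_nomeas; apply: filterS kz => x phix.
    by rewrite patchE -[x \in _]/(phi x \in B) phix zB.
  rewrite -[RHS](@integral0 _ _ _ (k z) setT); apply: ae_eq_integral_nomeas.
  apply: filterS kz => x phix.
  by rewrite patchE -[x \in _]/(phi x \in B) phix (negbTE zB).
- by move=> A mA; exact: measurable_kernel.
- by case: kQ.
- by apply/(measurable_restrictT _ mphiB)/measurable_funTS.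
- by apply: erestrict_ge0 => x _.
Qed.

End regular_conditional.

(** * Conditional densities *)

Section chain_rule.
Context d d' (X : measurableType d) (Z : measurableType d') (K : realType).
Variables (R : {measure set X -> \bar K}) (P : probability X K).
Variables (phi : {mfun X >-> Z}) (R_cond P_cond : K.-pker Z ~> X).
Hypothesis mset1 : forall z : Z, measurable [set z].
Hypothesis R_condP : is_regular_conditional R phi R_cond.
Hypothesis P_condP : is_regular_conditional P phi P_cond.

Let Q := distribution P phi.
Let S := image_measure R phi.

Let measurable_preimage B : measurable B -> measurable (phi @^-1` B).
Proof.
by move=> mB; rewrite -[X in measurable X]setTI; exact: measurable_funP.
Qed.

Lemma image_null_dominates : P `<< R -> Q `<< S.
Proof.
move=> /null_content_dominatesP PR; apply/null_content_dominatesP => B mB.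
by apply: PR; exact: measurable_preimage.
Qed.

Section density.
Variables (p : X -> K) (q : Z -> K).
Hypotheses (pP : is_density R P p) (qQ : is_density S Q q).

Let mp : measurable_fun setT (EFin \o p).
Proof. by apply/measurable_EFinP; case: pP. Qed.

Let p0 x : 0 <= (p x)%:E. Proof. by rewrite lee_fin; case: pP. Qed.

Let mpA A : measurable A -> measurable_fun setT ((EFin \o p) \_ A).
Proof. by move=> mA; exact/(measurable_restrictT _ mA)/measurable_funTS. Qed.

Let pA0 A x : 0 <= ((EFin \o p) \_ A) x.
Proof. by apply: erestrict_ge0 => y _; exact: p0. Qed.

(** Both sides, integrated over an event [B], give [P (A `&` phi @^-1` B)]. *)
Lemma ae_cond_density A : measurable A ->
  {ae S, forall z, (q z)%:E * P_cond z A = \int[R_cond z]_(x in A) (p x)%:E}.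
Proof.
move=> mA; have [mq q0 QE] := qQ.
have mPA : measurable_fun setT (P_cond ^~ A) by exact: measurable_kernel.
have mqP : measurable_fun setT (fun z => (q z)%:E * P_cond z A).
  by apply: emeasurable_funM => //; exact/measurable_EFinP.
have qP0 z : 0 <= (q z)%:E * P_cond z A by rewrite mule_ge0// lee_fin.
have lhsE B : measurable B -> \int[S]_(z in B) ((q z)%:E * P_cond z A) =
    P (A `&` phi @^-1` B).
  move=> mB; transitivity (\int[Q]_z ((P_cond ^~ A) \_ B) z).
    rewrite (integral_density qQ).
    - rewrite [LHS]integral_mkcond; apply: eq_integral => z _; rewrite !patchE.
      by case: ifPn => _; rewrite ?mule0.
    - by apply/(measurable_restrictT _ mB)/measurable_funTS.
    - by apply: erestrict_ge0 => z _; exact: measure_ge0.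
  rewrite -integral_mkcond.
  transitivity
    (\int[image_measure P phi]_(z in B) \int[P_cond z]_x (\1_A x)%:E).
    by apply: eq_integral => z _; rewrite integral_indic// setIT.
  rewrite -integral_regular_conditional//.
  + rewrite integral_indic//; exact: measurable_preimage.
  + exact/measurable_EFinP/measurable_indic.
have : ae_eq S setT (fun z => (q z)%:E * P_cond z A)
                    (fun z => \int[R_cond z]_(x in A) (p x)%:E).
  apply: integral_ae_eq => //.
  - apply/integrableP; split => //.
    under eq_integral do rewrite gee0_abs//.
    rewrite lhsE// ltey_eq fin_num_measure//.
    by apply: measurableI => //; exact: measurable_preimage.
  - rewrite (_ : (fun _ => _) =
        fun z => \int[R_cond z]_x ((EFin \o p) \_ A) x); last first.
      by apply/funext => z; rewrite integral_mkcond.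
    apply: measurable_fun_integral_kernel => //.
      by move=> U mU; exact: measurable_kernel.
    exact: mpA.
  - move=> B _ mB; rewrite lhsE//.
    under [RHS]eq_integral do rewrite integral_mkcond.
    rewrite -integral_regular_conditional//; last exact: mpA.
    rewrite -integral_mkcondr setIC.
    have [_ _ ->//] := pP.
    by apply: measurableI => //; exact: measurable_preimage.
by apply: filterS => z; exact.
Qed.

Hypothesis countably_generated : exists G : set (set X),
  [/\ countable G, setI_closed G, G setT & measurable = <<s G >>].

(** The exceptional null set of [ae_cond_density] depends on the event. Taking
    the union over a countable generating pi-system, on which measures are
    determined, makes it uniform. *)
Lemma ae_density_cond : {ae S, forall z, (0 < q z)%R ->
  is_density (R_cond z) (P_cond z) (fun x => p x / q z)%R}.
Proof.
have [G [cG IG GT GE]] := countably_generated.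
have mG A : G A -> measurable A by rewrite GE; exact: sub_sigma_algebra.
have [a Ga] : exists a : nat -> set X, (forall n, G (a n)) /\ G `<=` range a.
  have /pfcard_geP[G0|[f]] := cG; first by rewrite G0 in GT.
  exists f; split; first by move=> n; exact: funS.
  by move=> A GA; have [n _ <-] := @surj _ _ _ _ f A GA; exists n.
have : {ae S, forall z n, (q z)%:E * P_cond z (a n) =
    \int[R_cond z]_(x in a n) (p x)%:E}.
  by apply/ae_foralln => n; apply: ae_cond_density; apply: mG; case: Ga.
apply: filterS => z az qz0.
have [m mE] := measure_of_density (R_cond z) mp p0.
have q0 : (0 <= q z)%R by exact: ltW.
have mPE : forall A, measurable A ->
    mscale (NngNum q0) (kernel_prob P_cond z) A = m A.
  apply: (measure_unique G (fun=> setT)) => //.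
  - by rewrite bigcup_const.
  - move=> A GA; rewrite mE.
    by have [_ /(_ A GA)[n _ <-]] := Ga; rewrite -az.
  - move=> _; rewrite -[X in X < _]/((q z)%:E * kernel_prob P_cond z setT).
    by rewrite probability_setT mule1 ltry.
have mp' : measurable_fun setT p by case: pP.
split.
- by apply: measurable_funM.
- by move=> x; rewrite divr_ge0//; case: pP.
- move=> A mA; have := mPE A mA.
  rewrite -[X in X = _ -> _]/((q z)%:E * P_cond z A) mE.
  move=> /(congr1 (fun y => (q z)^-1%:E * y)).
  rewrite muleA -EFinM mulVf ?gt_eqF// mul1e => ->.
  rewrite -ge0_integralZl//.
  + by apply: eq_integral => x _; rewrite -EFinM mulrC.
  + exact: measurable_funTS.
  + by move=> x _; exact: p0.
  + by rewrite lee_fin invr_ge0.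
Qed.

Let r x := (ln (p x) - ln (q (phi x)))%R.

Let ae_image (A : Z -> Prop) : P `<< R ->
  {ae S, forall z, A z} -> {ae Q, forall z, A z}.
Proof.
move=> /image_null_dominates/null_content_dominatesP QS [N [mN N0 AN]].
by exists N; split => //; exact: QS.
Qed.

(** The logarithm of the conditional density [p / q z] agrees with [r] on the
    fibre over [z], and [r] is the same function for all [z]. *)
Lemma ae_prob_entropy_cond : {ae Q, forall z,
  [/\ prob_entropy (kernel_prob P_cond z) (kernel_prob R_cond z) =
        \int[P_cond z]_x (r x)%:E,
      \int[P_cond z]_x (EFin \o r)^\- x <= 1 &
      0 <= \int[P_cond z]_x (r x)%:E]}.
Proof.
have PR := density_null_dominates pP.
have H := ae_image PR ae_density_cond.
have F := regular_conditional_fiber mset1 P_condP.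
apply: filterS3 H (density_gt0 qQ) F => z H qz0 F.
have {}H : is_density (kernel_prob R_cond z) (kernel_prob P_cond z)
  (fun x => p x / q z)%R by exact: H.
have rE : {ae P_cond z, forall x, ln (p x / q z) = r x}.
  apply: filterS2 (density_gt0 H) F => x pq0 phix.
  have px0 : (0 < p x)%R by move: pq0; rewrite pmulr_lgt0// invr_gt0.
  by rewrite ln_div ?posrE// /r phix.
have [_ L1 L0] := integral_ln_density H.
have rE1 : \int[P_cond z]_x (ln (p x / q z))%:E = \int[P_cond z]_x (r x)%:E.
  by apply: ae_eq_integral_nomeas; apply: filterS rE => x ->.
rewrite -rE1 (prob_entropy_density H); split => //.
apply: le_trans L1; rewrite le_eqVlt; apply/orP; left; apply/eqP.
apply: ae_eq_integral_nomeas; apply: filterS rE => x rx.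
by rewrite !funenegE/= rx.
Qed.

Let mr : measurable_fun setT r.
Proof.
have [mp' _ _] := pP; have [mq _ _] := qQ.
apply: measurable_funB; apply: measurableT_comp => //.
exact: measurableT_comp.
Qed.

(** The positive and negative parts of [r] are disintegrated separately; the
    integral of the negative part is at most 1 on almost every fibre, so the
    difference can be taken before or after integrating over [z]. *)
Lemma integral_prob_entropy_cond : lower_integrable P r /\
  \int[P]_x (r x)%:E = \int[Q]_z
    prob_entropy (kernel_prob P_cond z) (kernel_prob R_cond z).
Proof.
pose a z := \int[P_cond z]_x (EFin \o r)^\+ x.
pose b z := \int[P_cond z]_x (EFin \o r)^\- x.
have mrp : measurable_fun setT (EFin \o r)^\+.
  exact/measurable_funepos/measurable_EFinP.
have mrn : measurable_fun setT (EFin \o r)^\-.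
  exact/measurable_funeneg/measurable_EFinP.
have ma : measurable_fun setT a.
  by apply: measurable_fun_integral_kernel => // U mU; exact: measurable_kernel.
have mb : measurable_fun setT b.
  by apply: measurable_fun_integral_kernel => // U mU; exact: measurable_kernel.
have a0 z : 0 <= a z by exact: integral_ge0.
have b0 z : 0 <= b z by exact: integral_ge0.
have IaE : \int[P]_x (EFin \o r)^\+ x = \int[Q]_z a z.
  rewrite -[setT](preimage_setT phi).
  by rewrite (integral_regular_conditional mset1 P_condP).
have IbE : \int[P]_x (EFin \o r)^\- x = \int[Q]_z b z.
  rewrite -[setT](preimage_setT phi).
  by rewrite (integral_regular_conditional mset1 P_condP).
have Ib1 : \int[Q]_z b z <= 1.
  apply: (@le_trans _ _ (\int[Q]_z cst 1 z)); last first.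
    by rewrite integral_cst// mul1e; exact: probability_le1.
  apply: ae_ge0_le_integral_nomeas => //.
  by apply: filterS ae_prob_entropy_cond => z [].
have Ibfin : \int[Q]_z b z \is a fin_num.
  by rewrite ge0_fin_numE ?integral_ge0// (le_lt_trans Ib1)// ltry.
split; first by split => //; rewrite IbE (le_lt_trans Ib1)// ltry.
rewrite integralE -/(EFin \o r) IaE IbE.
(* The maximum with 0 makes [H] nonnegative also on the null set where [b] may
   be infinite. *)
pose H z := maxe (a z - b z) 0.
have mH : measurable_fun setT H.
  by apply: measurable_maxe => //; exact: emeasurable_funB.
have HE : {ae Q, forall z,
    prob_entropy (kernel_prob P_cond z) (kernel_prob R_cond z) = H z /\
    a z = H z + b z}.
  apply: filterS ae_prob_entropy_cond => z [-> b1].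
  rewrite integralE -/(a z) -/(b z) => ab0; split.
    by rewrite /H max_l.
  have bfin : b z \is a fin_num.
    by rewrite ge0_fin_numE// (le_lt_trans b1)// ltry.
  by rewrite /H max_l// subeK.
transitivity (\int[Q]_z H z); last first.
  by apply: ae_eq_integral_nomeas; apply: filterS HE => z [->].
have -> : \int[Q]_z a z = \int[Q]_z H z + \int[Q]_z b z.
  rewrite -ge0_integralD//.
    by apply: ae_eq_integral_nomeas; apply: filterS HE => z [].
  by move=> z _; rewrite /H le_max lexx orbT.
by rewrite addeK.
Qed.

End density.
End chain_rule.

(** * The chain rule *)

Lemma lower_integrable_gtNy d (X : measurableType d) (K : realType)
    (mu : {measure set X -> \bar K}) (f : X -> K) :
  lower_integrable mu f -> -oo < \int[mu]_x (f x)%:E.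
Proof.
move=> [_ fn]; rewrite integralE.
have : 0 <= \int[mu]_x (EFin \o f)^\+ x by exact: integral_ge0.
have : \int[mu]_x (EFin \o f)^\- x \is a fin_num.
  by rewrite ge0_fin_numE// integral_ge0.
rewrite -/(EFin \o f).
by move: (integral _ _ _) (integral _ _ _) => [a||] [b||]//= _ _; rewrite ltNyr.
Qed.

Lemma lower_integrable_pushforward d d' (X : measurableType d)
    (Z : measurableType d') (K : realType) (P : {measure set X -> \bar K})
    (phi : {mfun X >-> Z}) (f : Z -> K) :
  lower_integrable (image_measure P phi) f ->
  lower_integrable P (f \o phi) /\
  \int[image_measure P phi]_z (f z)%:E = \int[P]_x (f (phi x))%:E.
Proof.
move=> [mf fn]; have mphi : measurable_fun setT phi by exact: measurable_funP.
have fE (g : Z -> \bar K) : measurable_fun setT g -> (forall z, 0 <= g z) ->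
    \int[image_measure P phi]_z g z = \int[P]_x (g \o phi) x.
  by move=> mg g0; rewrite [LHS]ge0_integral_pushforward// preimage_setT.
have mfE : measurable_fun setT (EFin \o f) by exact/measurable_EFinP.
have mfp := measurable_funepos mfE; have mfn := measurable_funeneg mfE.
split.
  split; first exact: measurableT_comp mf mphi.
  by move: fn; rewrite fE// -funeneg_comp.
rewrite [LHS]integralE [RHS]integralE (fE _ mfp)// (fE _ mfn)//.
by rewrite -(funepos_comp (EFin \o f)) -(funeneg_comp (EFin \o f)).
Qed.

Section entropy_chain_rule.
Context d d' (X : measurableType d) (Z : measurableType d') (K : realType).
Variables (R : {measure set X -> \bar K}) (P : probability X K).
Variables (phi : {mfun X >-> Z}) (R_cond P_cond : K.-pker Z ~> X).
Hypothesis mset1 : forall z : Z, measurable [set z].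
Hypothesis R_condP : is_regular_conditional R phi R_cond.
Hypothesis P_condP : is_regular_conditional P phi P_cond.
Hypothesis PR_defined : entropy_defined P R.
Hypothesis QS_defined :
  entropy_defined (distribution P phi) (image_measure R phi).

Let cond_entropy z :=
  prob_entropy (kernel_prob P_cond z) (kernel_prob R_cond z).

(** Some event [A] has [R A = 0] and [P A != 0]; then [R_cond z A = 0] for
    almost every [z], whereas [P_cond z A != 0] for [z] in a non-null set. *)
Lemma cond_entropyNac : ~ P `<< R ->
  distribution P phi `<< image_measure R phi ->
  \int[distribution P phi]_z cond_entropy z = +oo.
Proof.
move=> PR /null_content_dominatesP QS.
have [A [mA RA0 PA0]] : exists A, [/\ measurable A, R A = 0 & P A != 0].
  apply: contrapT => PR'; apply: PR; apply/null_content_dominatesP => A mA RA0.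
  by apply/eqP; apply: contrapT => /negP PA0; apply: PR'; exists A.
have mRA : measurable_fun setT (R_cond ^~ A) by exact: measurable_kernel.
have mPA : measurable_fun setT (P_cond ^~ A) by exact: measurable_kernel.
have [N [mN N0 RN]] : {ae image_measure R phi, forall z, R_cond z A = 0}.
  have : \int[image_measure R phi]_z `|R_cond z A| = 0.
    under eq_integral do rewrite gee0_abs//.
    by case: R_condP => /(_ _ mA) <-.
  by move/(ae_eq_integral_abs _ measurableT mRA); apply: filterS => z; exact.
have RA : {ae distribution P phi, forall z, R_cond z A = 0}.
  by exists N; split => //; exact: QS.
pose B := [set z | P_cond z A != 0].
have mB : measurable B.
  have -> : B = setT `&` (P_cond ^~ A) @^-1` (~` [set 0]).
    by rewrite setTI; apply/seteqP; split => z /= /eqP.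
  by apply: mPA => //; apply: measurableC.
have QB : distribution P phi B != 0.
  apply: contra_neq PA0 => QB0; case: P_condP => /(_ _ mA) -> _.
  rewrite -(@integral0 _ _ _ (image_measure P phi) setT).
  apply: ae_eq_integral_nomeas; exists B; split => //.
  by move=> z /= /eqP.
apply/eqP; rewrite -leye_eq.
have -> : +oo = \int[distribution P phi]_z ((cst +oo \_ B) z) :> \bar K.
  by rewrite -integral_mkcond integral_cst// gt0_mulye// lt0e QB measure_ge0.
apply: ae_ge0_le_integral_nomeas.
- by apply: erestrict_ge0 => z _; exact: leey.
- by move=> z; exact: prob_entropy_ge0.
apply: filterS RA => z RzA; rewrite patchE.
case: ifPn => [/set_mem PzA|_]; last first.
  exact: prob_entropy_ge0.
rewrite /cond_entropy /prob_entropy asboolF// => /null_content_dominatesP.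
by move/(_ A mA RzA)/eqP; rewrite (negbTE PzA).
Qed.

Hypothesis countably_generated : exists G : set (set X),
  [/\ countable G, setI_closed G, G setT & measurable = <<s G >>].

Lemma relative_entropy_chain_rule : relative_entropy P R =
  relative_entropy (distribution P phi) (image_measure R phi) +
  \int[distribution P phi]_z cond_entropy z.
Proof.
have H0 : 0 <= \int[distribution P phi]_z cond_entropy z.
  by apply: integral_ge0 => z _; exact: prob_entropy_ge0.
have [PR|PR] := pselect (P `<< R); last first.
  rewrite (relative_entropyNac PR).
  have [QS|QS] := pselect (distribution P phi `<< image_measure R phi).
    rewrite cond_entropyNac// addey//.
    have [q [_ lq ->]] := relative_entropy_density QS_defined QS.
    by rewrite gt_eqF// (lower_integrable_gtNy lq).
  rewrite (relative_entropyNac QS) addye//.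
  by rewrite gt_eqF// (lt_le_trans _ H0).
have [p [pP lp ->]] := relative_entropy_density PR_defined PR.
have QS : distribution P phi `<< image_measure R phi.
  exact: image_null_dominates.
have [q [qQ lq ->]] := relative_entropy_density QS_defined QS.
have [lr <-] := integral_prob_entropy_cond mset1 R_condP P_condP pP qQ
  countably_generated.
have [lqphi qE] := @lower_integrable_pushforward _ _ _ _ _ P phi _ lq.
rewrite [X in _ = X + _]qE.
rewrite -integralD_lower_integrable//; apply: eq_integral => x _.
by rewrite subrKC.
Qed.

End entropy_chain_rule.

Theorem theorem2p4 (K : realType) (Omega Z : ptopologicalType)
    (polish_Omega : polish K Omega) (polish_Z : polish K Z)
    (R : {sigma_finite_measure set (borel Omega) -> \bar K})
    (phi : {mfun borel Omega >-> borel Z})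
    (Rphi_sigma_finite : sigma_finite [set: borel Z] (image_measure R phi))
    (R_cond : K.-pker (borel Z) ~> (borel Omega))
    (R_condP : is_regular_conditional R phi R_cond)
    (P : probability (borel Omega) K)
    (P_cond : K.-pker (borel Z) ~> (borel Omega))
    (P_condP : is_regular_conditional P phi P_cond)
    (PR_defined : entropy_defined P R)
    (PRphi_defined : entropy_defined (distribution P phi) (image_measure R phi)) :
  relative_entropy P R =
    relative_entropy (distribution P phi) (image_measure R phi) +
    \int[distribution P phi]_z
      prob_entropy (kernel_prob P_cond z) (kernel_prob R_cond z).
Proof.
apply: relative_entropy_chain_rule => //.
- exact: polish_measurable_set1 polish_Z.
- exact: polish_countably_generated polish_Omega.
Qed.
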